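(* Let $m$ be a positive integer, $r$ a nonnegative integer, $\lambda\in\mathbb{R}$. For integers $n\ge l\ge0$, $$V_{m,\lambda}^{(r+1)}(n,l)=\sum_{k=l}^{n}\binom{k}{l}(-1)^{k-l}\langle 1\rangle_{k-l,\lambda}V_{m,\lambda}^{(r)}(n,k).$$
   Context: $(x)_{0,\lambda}=1$, $(x)_{n,\lambda}=x(x-\lambda)\cdots(x-(n-1)\lambda)$; $\langle x\rangle_{0,\lambda}=1$, $\langle x\rangle_{n,\lambda}=x(x+\lambda)\cdots(x+(n-1)\lambda)$; $(x)_n=(x)_{n,1}$. For a nonnegative integer $s$, the degenerate $s$-Whitney numbers of the first kind are defined by the polynomial identities $m^n(x)_n=\sum_{k=0}^n V_{m,\lambda}^{(s)}(n,k)(mx+s)_{k,\lambda}$. *)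

(* Defs.v *)
From mathcomp Require Export all_boot all_order all_algebra.
From mathcomp Require Export reals.
Set Implicit Arguments. Unset Strict Implicit. Unset Printing Implicit Defensive.
Import Order.TTheory GRing.Theory Num.Theory.
Local Open Scope ring_scope.

(* (x)_{n,lam} = x (x - lam) ... (x - (n-1) lam); over an arbitrary commutative
   ring so that it applies both to scalars and to polynomials. *)
Definition dfall (A : comNzRingType) (lam x : A) (n : nat) : A :=
  \prod_(i < n) (x - i%:R * lam).

(* <x>_{n,lam} = x (x + lam) ... (x + (n-1) lam) *)
Definition drise (A : comNzRingType) (lam x : A) (n : nat) : A :=
  \prod_(i < n) (x + i%:R * lam).

(* The polynomial identities m^n (x)_n = sum_{k=0}^n V(n,k) (m x + s)_{k,lam}
   in R[x], for all n.  Only the values V n k with k <= n are constrained. *)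
Definition is_degenerate_whitney1 (R : realType) (m : nat) (lam : R) (s : nat)
    (V : nat -> nat -> R) : Prop :=
  forall n : nat,
    (m%:R ^+ n) *: dfall (1 : {poly R}) 'X n =
    \sum_(0 <= k < n.+1)
      V n k *: dfall (lam%:P : {poly R}) (m%:R *: 'X + (s%:R)%:P) k.

(* Witness that the identities above are satisfiable.  The recurrence comes from
   (m x - m n) (m x + s)_{k,lam} = (m x + s)_{k+1,lam}
                                   + (k lam - s - m n) (m x + s)_{k,lam}. *)
Fixpoint whitney1_rec (R : realType) (m : nat) (lam : R) (s n k : nat) : R :=
  if n is n'.+1 then
    (if k is k'.+1 then whitney1_rec m lam s n' k' else 0)
    + (k%:R * lam - s%:R - m%:R * n'%:R) * whitney1_rec m lam s n' k
  else (k == 0)%:R.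

Lemma whitney1_rec_gt (R : realType) (m : nat) (lam : R) (s n k : nat) :
  (n < k)%N -> whitney1_rec m lam s n k = 0.
Proof.
elim: n k => [|n IH] [|k] //= ltnk.
by rewrite !IH ?mulr0 ?addr0 // ltnW.
Qed.

Lemma whitney1_recP (R : realType) (m : nat) (lam : R) (s : nat) :
  is_degenerate_whitney1 m lam s (whitney1_rec m lam s).
Proof.
elim=> [|n IH].
  by rewrite big_nat1 /dfall !big_ord0 expr0 /=.
set y := m%:R *: 'X + (s%:R)%:P.
have -> : m%:R ^+ n.+1 *: dfall 1 'X n.+1 =
    (m%:R ^+ n *: dfall (1 : {poly R}) 'X n) * (y - (s%:R + m%:R * n%:R)%:P).
  rewrite /dfall big_ord_recr /= exprSr -scalerA -!scalerAl scalerAr.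
  congr (_ *: (_ * _)); rewrite /y polyCD opprD addrA addrK.
  by rewrite mulr1 scalerBr polyCM -mul_polyC -mul_polyC polyC_natr polyC_natr.
have step k : dfall (lam%:P) y k * (y - (s%:R + m%:R * n%:R)%:P) =
    dfall (lam%:P) y k.+1
    + (k%:R * lam - s%:R - m%:R * n%:R) *: dfall (lam%:P) y k.
  rewrite {2}/dfall big_ord_recr /= -/(dfall _ _ _) -mul_polyC.
  rewrite [_%:P * dfall _ _ _]mulrC -mulrDr; congr (_ * _).
  rewrite -polyC_natr -polyCM -[in RHS]addrA -!polyCN -polyCD.
  by congr (_ + _%:P); rewrite opprD !addrA addNr add0r.
rewrite IH mulr_suml -/y.
under eq_bigr => k _ do rewrite -scalerAl step scalerDr scalerA.
rewrite big_split /=.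
under [RHS]eq_bigr => k _ do rewrite scalerDl.
rewrite big_split /=; congr (_ + _).
  by rewrite [RHS]big_nat_recl //= scale0r add0r.
rewrite [RHS]big_nat_recr //= whitney1_rec_gt // mulr0 scale0r addr0.
by apply: eq_bigr => k _; rewrite mulrC.
Qed.

(* Main.v *)
Require Import Defs.
From mathcomp Require Import ring.
Import Order.TTheory GRing.Theory Num.Theory.
Local Open Scope ring_scope.

(** Put y = m x + s + d, so that m x + s = y - d. The binomial theorem for
    degenerate falling factorials expands (y - d)_{k,lam} in the (y)_{l,lam}
    with coefficients C(k,l) (-1)^(k-l) <d>_{k-l,lam}. Substituted in the
    identities defining V^(s), this exhibits a solution of those defining
    V^(s+d). That solution is the only one because the (y)_{l,lam} have
    pairwise distinct degrees; the theorem is the case d = 1. *)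

Lemma exchange_big_nat_triangle (T : Type) (idx : T) (op : Monoid.com_law idx)
    (F : nat -> nat -> T) (n : nat) :
  \big[op/idx]_(0 <= k < n) \big[op/idx]_(0 <= l < k.+1) F k l =
  \big[op/idx]_(0 <= l < n) \big[op/idx]_(l <= k < n) F k l.
Proof.
rewrite big_nat.
under eq_bigr => k /andP[_ lt_kn] do rewrite (big_nat_widen _ _ _ _ _ lt_kn).
rewrite -big_nat (exchange_big_dep_nat xpredT) //=.
by apply: eq_bigr => l _; rewrite [RHS](big_nat_widenl _ 0).
Qed.

Section DegenerateFactorials.

Variables (A : comNzRingType) (lam : A).
Implicit Types (x y : A) (n : nat).

Lemma dfall0 x : dfall lam x 0 = 1.
Proof. by rewrite /dfall big_ord0. Qed.

Lemma dfallS x n : dfall lam x n.+1 = dfall lam x n * (x - n%:R * lam).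
Proof. by rewrite /dfall big_ord_recr. Qed.

Lemma dfallN x n : dfall lam (- x) n = (-1) ^+ n * drise lam x n.
Proof.
rewrite /dfall /drise -[X in _ ^+ X]card_ord -prodrN.
by apply: eq_bigr => i _; rewrite opprD.
Qed.

Lemma dfallDn x y n :
  dfall lam (x + y) n =
  \sum_(0 <= i < n.+1) (dfall lam x (n - i) * dfall lam y i) *+ 'C(n, i).
Proof.
elim: n => [|n IHn]; first by rewrite big_nat1 !dfall0 mulr1.
pose t i := dfall lam x (n.+1 - i) * dfall lam y i.
have split_factor i : (i <= n)%N ->
    dfall lam x (n - i) * dfall lam y i * (x + y - n%:R * lam) = t i + t i.+1.
  by move=> le_in; rewrite /t subSS subSn // !dfallS natrB //; ring.
transitivity (\sum_(0 <= i < n.+1) t i *+ 'C(n, i)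
              + \sum_(0 <= i < n.+1) t i.+1 *+ 'C(n, i)).
  rewrite dfallS IHn mulr_suml -big_split /=.
  apply: eq_big_nat => i /andP[_ lt_in].
  by rewrite mulrnAl split_factor // mulrnDl.
have -> : \sum_(0 <= i < n.+1) t i *+ 'C(n, i) =
          \sum_(0 <= i < n.+2) t i *+ 'C(n, i).
  by rewrite [RHS]big_nat_recr //= bin_small // mulr0n addr0.
rewrite [X in X + _]big_nat_recl // [RHS]big_nat_recl // !bin0.
rewrite -addrA -big_split /=; congr (_ + _).
by apply: eq_bigr => i _; rewrite binS mulrnDr.
Qed.

Lemma dfallBn x y n :
  dfall lam (x - y) n =
  \sum_(0 <= i < n.+1)
    ((-1) ^+ (n - i) * drise lam y (n - i) * dfall lam x i) *+ 'C(n, i).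
Proof. by rewrite addrC dfallDn; under eq_bigr do rewrite dfallN. Qed.

Lemma rmorph_drise (B : comNzRingType) (f : {rmorphism A -> B}) x n :
  f (drise lam x n) = drise (f lam) (f x) n.
Proof.
rewrite /drise rmorph_prod; apply: eq_bigr => i _.
by rewrite rmorphD rmorphM rmorph_nat.
Qed.

End DegenerateFactorials.

Lemma size_dfall (R : idomainType) (lam p : {poly R}) (n : nat) :
  (size lam < size p)%N -> size (dfall lam p n) = (n * (size p).-1).+1.
Proof.
move=> lt_lam_p; elim: n => [|n IHn]; first by rewrite dfall0 size_poly1.
have size_factor : size (p - n%:R * lam) = size p.
  rewrite size_polyDl // size_polyN mulr_natl -scaler_nat.
  exact: leq_ltn_trans (size_scale_leq _ _) lt_lam_p.
have p_gt0 : (0 < size p)%N := leq_ltn_trans (leq0n _) lt_lam_p.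
rewrite dfallS size_mul -?size_poly_gt0 ?IHn ?size_factor //.
by case: (size p) p_gt0 => // d _; rewrite addSn addnS mulSn addnC.
Qed.

Lemma size_homo_lincomb_inj (R : idomainType) (p : nat -> {poly R})
    (a b : nat -> R) (n : nat) :
  (forall k, p k != 0) ->
  {homo (fun k => size (p k)) : i j / (i < j)%N} ->
  \sum_(0 <= k < n) a k *: p k = \sum_(0 <= k < n) b k *: p k ->
  forall k, (k < n)%N -> a k = b k.
Proof.
move=> p_neq0 size_p; elim: n => [//|n IHn].
have low_coef (c : nat -> R) :
    (\sum_(0 <= k < n) c k *: p k)`_(size (p n)).-1 = 0.
  rewrite coef_sum big_nat big1 // => k /andP[_ /size_p lt_size].
  by rewrite coefZ nth_default ?mulr0 // -ltnS (ltn_predK lt_size).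
rewrite !big_nat_recr //= => eq_ab.
have top_coef : a n = b n.
  move/(congr1 (coefp (size (p n)).-1)): (eq_ab).
  rewrite /= !coefD !low_coef !add0r !coefZ -lead_coefE.
  by apply: mulIf; rewrite lead_coef_eq0.
move: eq_ab; rewrite top_coef => /addIr/IHn eq_ab k.
by rewrite ltnS leq_eqVlt => /predU1P[->|/eq_ab].
Qed.

Section DegenerateWhitney.

Variables (R : realType) (m : nat) (lam : R).
Implicit Types (V W : nat -> nat -> R) (s d n k : nat).

Lemma degenerate_whitney1_uniq s V W :
  (0 < m)%N ->
  is_degenerate_whitney1 m lam s V -> is_degenerate_whitney1 m lam s W ->
  forall n k, (k <= n)%N -> V n k = W n k.
Proof.
move=> m_gt0 VP WP n.
pose y : {poly R} := m%:R *: 'X + (s%:R)%:P.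
have size_y : size y = 2.
  have m_neq0 : m%:R != 0 :> R by rewrite pnatr_eq0 -lt0n.
  by rewrite /y -mul_polyC size_MXaddC polyC_eq0 size_polyC (negPf m_neq0).
have size_dfall_y k : size (dfall lam%:P y k) = k.+1.
  by rewrite size_dfall size_y ?muln1 // ltnS size_polyC_leq1.
apply: (size_homo_lincomb_inj _ (dfall lam%:P y) _ _ n.+1).
- by move=> k; rewrite -size_poly_gt0 size_dfall_y.
- by move=> i j lt_ij; rewrite !size_dfall_y.
- by rewrite -(VP n) -(WP n).
Qed.

Lemma degenerate_whitney1_shift s d V :
  is_degenerate_whitney1 m lam s V ->
  is_degenerate_whitney1 m lam (s + d) (fun n l =>
    \sum_(l <= k < n.+1)
      'C(k, l)%:R * (-1) ^+ (k - l) * drise lam d%:R (k - l) * V n k).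
Proof.
move=> VP n; rewrite (VP n).
set y := _ + ((s + d)%:R)%:P.
have -> : m%:R *: 'X + (s%:R)%:P = y - (d%:R)%:P.
  by rewrite /y natrD polyCD addrA addrK.
under eq_bigr do rewrite dfallBn scaler_sumr.
rewrite exchange_big_nat_triangle.
apply: eq_bigr => l _; rewrite scaler_suml; apply: eq_bigr => k _.
rewrite -rmorph_drise -!mul_polyC !polyCM polyC_natr polyC_exp polyCN; ring.
Qed.

End DegenerateWhitney.

Theorem theorem9 (R : realType) (m r : nat) (lam : R)
    (V : nat -> nat -> nat -> R)
    (m_gt0 : (0 < m)%N)
    (hV : forall s : nat, is_degenerate_whitney1 m lam s (V s))
    (n l : nat) (le_ln : (l <= n)%N) :
  V r.+1 n l =
  \sum_(l <= k < n.+1)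
    'C(k, l)%:R * (-1) ^+ (k - l) * drise lam 1 (k - l) * V r n k.
Proof.
have shiftV := degenerate_whitney1_shift R m lam r 1 (V r) (hV r).
rewrite addn1 in shiftV.
exact: (degenerate_whitney1_uniq R m lam r.+1 _ _ m_gt0 (hV r.+1) shiftV).
Qed.
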